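(* The system $$\begin{aligned} &\partial_t u=\mathcal{D}\Bigg(-\frac{\frac{\partial g}{\partial u}(u,u_x)-\partial_x\frac{\partial g}{\partial u_x}(u,u_x)}{2\sqrt{(g(u,u_x),1)+C_1}}\,q_1+\frac{\frac{\partial h}{\partial u}(u,u_x)-\partial_x\frac{\partial h}{\partial u_x}(u,u_x)}{2\sqrt{(h(u,u_x),1)+C_2}}\,q_2+\frac14(u-u_{xx})\Bigg),\\ &\frac{d}{dt}q_1=\Bigg(\frac{1}{2\sqrt{(g(u,u_x),1)+C_1}}\Big(\frac{\partial g}{\partial u}(u,u_x)-\partial_x\frac{\partial g}{\partial u_x}(u,u_x)\Big),\,u_t\Bigg),\\ &\frac{d}{dt}q_2=\Bigg(\frac{1}{2\sqrt{(h(u,u_x),1)+C_2}}\Big(\frac{\partial h}{\partial u}(u,u_x)-\partial_x\frac{\partial h}{\partial u_x}(u,u_x)\Big),\,u_t\Bigg),\\ &u(x,0)=u_0(x),\quad q_1(0)=\sqrt{(g(u_0(x),\partial_xu_0(x)),1)+C_1},\quad q_2(0)=\sqrt{(h(u_0(x),\partial_xu_0(x)),1)+C_2},\\ &u(x+L,t)=u(x,t), \end{aligned}$$ possesses the following modified energy conservation law: $$\frac{d}{dt}\mathcal{H}=0,\qquad \mathcal{H}=\frac18\int_a^b(u^2+u_x^2)\,dx-\frac12q_1^2+\frac12q_2^2+\frac12C_1-\frac12C_2.$$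
   Context: The system is a reformulation of the Camassa-Holm equation $u_t-u_{xxt}+3uu_x-2u_xu_{xx}-uu_{xxx}=0$, $a<x<b$, $0<t\le T$, with initial condition $u(x,0)=u_0(x)$ and periodic boundary condition $u(x+L,t)=u(x,t)$, where $L=b-a$. The unknowns are $u=u(x,t)$ and the scalar auxiliary variables $q_1=q_1(t)$, $q_2=q_2(t)$, introduced as $q_1=\sqrt{(g(u,u_x),1)+C_1}$ and $q_2=\sqrt{(h(u,u_x),1)+C_2}$. Here $(v,w)=\int_a^b vw\,dx$, and $$g(u,u_x)=(u+\tfrac12)^2(u^2+u_x^2),\qquad h(u,u_x)=u^2(u^2+u_x^2),$$ so that $$\frac{\partial g}{\partial u}=2(u+\tfrac12)(2u^2+u_x^2+\tfrac12u),\quad \frac{\partial g}{\partial u_x}=2u_x(u+\tfrac12)^2,\quad \frac{\partial h}{\partial u}=4u^3+2uu_x^2,\quad \frac{\partial h}{\partial u_x}=2u_xu^2.$$ $C_1$ and $C_2$ are two constants large enough to make $q_1$ and $q_2$ well-defined. $\mathcal{D}=(1-\partial_{xx})^{-1}\partial_x$ is a skew-adjoint operator. *)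

(* Defs.v *)
From Stdlib Require Import Reals Lra Lia.
From Coquelicot Require Import Coquelicot.
Open Scope R_scope.

Definition g (u p : R) : R := (u + 1/2)^2 * (u^2 + p^2).
Definition h (u p : R) : R := u^2 * (u^2 + p^2).

Definition inner (a b : R) (v w : R -> R) : R := RInt (fun x => v x * w x) a b.

Definition periodic (L : R) (v : R -> R) : Prop := forall x, v (x + L) = v x.

(* (phi(w,w_x),1) + C, the radicand of the auxiliary variables. *)
Definition radicand (a b C : R) (phi : R -> R -> R) (w : R -> R) : R :=
  inner a b (fun x => phi (w x) (Derive w x)) (fun _ => 1) + C.

(* The function dphi/du(w,w_x) - d/dx [ dphi/du_x(w,w_x) ]. *)
Definition variational (phi : R -> R -> R) (w : R -> R) (x : R) : R :=
  Derive (fun v => phi v (Derive w x)) (w x)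
  - Derive (fun y => Derive (fun p => phi (w y) p) (Derive w y)) x.

(* [is_inv_helmholtz L f v] is the graph of the inverse of 1 - d_xx, acting on
   twice differentiable L-periodic functions: v = (1 - d_xx)^{-1} f. Such a v
   is unique ([inv_helmholtz_unique]). *)
Definition is_inv_helmholtz (L : R) (f v : R -> R) : Prop :=
  periodic L v /\
  (forall k x, (k <= 2)%nat -> ex_derive_n v k x) /\
  (forall x, v x - Derive_n v 2 x = f x).

Lemma periodic_exp_eq0 (c L : R) (p : R -> R) :
  c <> 0 -> 0 < L -> (forall x, is_derive p x (c * p x)) -> p L = p 0 ->
  forall x, p x = 0.
Proof.
intros Hc HL Hp HpL.
assert (E : forall x, p x = p 0 * exp (c * x)).
{ intros x.
  assert (D : forall y, is_derive (fun y => p y * exp (- (c * y))) y 0).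
  { intros y. specialize (Hp y).
    auto_derive; [now exists (c * p y)|].
    replace (Derive (fun x0 => p x0) y) with (c * p y)
      by (symmetry; exact (is_derive_unique p y _ Hp)).
    ring. }
  assert (K : p x * exp (- (c * x)) = p 0 * exp (- (c * 0))).
  { destruct (MVT_gen (fun y => p y * exp (- (c * y))) 0 x (fun _ => 0))
      as [z [_ Hz]].
    - intros y _. apply D.
    - intros y _. apply continuity_pt_filterlim.
      apply (ex_derive_continuous (fun y => p y * exp (- (c * y)))).
      exists 0. apply D.
    - lra. }
  rewrite Rmult_0_r, Ropp_0, exp_0, Rmult_1_r in K.
  rewrite <- K, Rmult_assoc, <- exp_plus.
  replace (- (c * x) + c * x) with 0 by ring. rewrite exp_0. ring. }
assert (Z : p 0 = 0).
{ destruct (Req_dec (p 0) 0) as [e|n]; [exact e|exfalso].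
  assert (X : exp (c * L) = exp 0).
  { rewrite exp_0. apply Rmult_eq_reg_l with (p 0); [|exact n].
    rewrite <- E, HpL. ring. }
  apply exp_inv in X. destruct (Rmult_integral _ _ X); lra. }
intros x. rewrite E, Z. ring.
Qed.

Lemma inv_helmholtz_unique (L : R) (f v1 v2 : R -> R) :
  0 < L -> is_inv_helmholtz L f v1 -> is_inv_helmholtz L f v2 ->
  forall x, v1 x = v2 x.
Proof.
intros HL [P1 [D1 E1]] [P2 [D2 E2]].
assert (B : forall v, (forall k x, (k <= 2)%nat -> ex_derive_n v k x) ->
  (forall x, is_derive v x (Derive v x)) /\
  (forall x, is_derive (Derive v) x (Derive_n v 2 x))).
{ intros v Hv. split; intros x; apply Derive_correct.
  - apply (Hv 1%nat x). lia.
  - apply (Hv 2%nat x). lia. }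
assert (Q : forall v, periodic L v -> Derive v L = Derive v 0).
{ intros v Pv. unfold Derive. f_equal. apply Lim_ext. intros k.
  replace (L + k) with (k + L) by ring.
  replace L with (0 + L) at 2 by ring. rewrite !Pv.
  now rewrite Rplus_0_l. }
assert (A : forall c, c * c = 1 -> forall x,
  (v1 x - v2 x) + c * (Derive v1 x - Derive v2 x) = 0).
{ intros c Hc.
  apply (periodic_exp_eq0 c L); [intros ->; lra | exact HL | |].
  - intros x.
    destruct (B v1 D1) as [B1 B1']. destruct (B v2 D2) as [B2 B2'].
    replace (c * (v1 x - v2 x + c * (Derive v1 x - Derive v2 x)))
      with ((Derive v1 x - Derive v2 x)
            + c * (Derive_n v1 2 x - Derive_n v2 2 x)).
    + apply (is_derive_plus (fun x => v1 x - v2 x)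
               (fun x => c * (Derive v1 x - Derive v2 x))).
      * apply (is_derive_minus v1 v2); auto.
      * apply (is_derive_scal (fun x => Derive v1 x - Derive v2 x)).
        apply (is_derive_minus (Derive v1) (Derive v2)); auto.
    + generalize (E1 x) (E2 x); intros F1 F2.
      replace (Derive_n v1 2 x) with (v1 x - f x) by lra.
      replace (Derive_n v2 2 x) with (v2 x - f x) by lra.
      rewrite Rmult_plus_distr_l, <- Rmult_assoc, Hc. ring.
  - rewrite (Q v1 P1), (Q v2 P2).
    generalize (P1 0) (P2 0). rewrite Rplus_0_l. intros -> ->. ring. }
intros x. generalize (A 1 ltac:(ring) x) (A (-1) ltac:(ring) x). lra.
Qed.

(* v = (1 - d_xx)^{-1} d_x F. *)
Definition is_calD (L : R) (F v : R -> R) : Prop :=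
  (forall x, ex_derive F x) /\ is_inv_helmholtz L (Derive F) v.

(* Derivative relative to a set I of times; it is the usual derivative at
   interior points of I and the one-sided derivative at the ends of an
   interval. *)
Definition is_derive_within (I : R -> Prop) (f : R -> R) (t l : R) : Prop :=
  filterdiff f (within I (locally t)) (fun y : R => scal y l).

(* The x-derivatives of v of order at most n exist and are jointly continuous
   in (x,t) for x real and t in I. *)
Definition jointly_Cx (n : nat) (I : R -> Prop) (v : R -> R -> R) : Prop :=
  forall k, (k <= n)%nat ->
    (forall x t, I t -> ex_derive_n (fun y => v y t) k x) /\
    continuous_on (fun z : R * R => I (snd z))
      (fun z : R * R => Derive_n (fun y => v y (snd z)) k (fst z)).

Definition flux (a b C1 C2 : R) (w : R -> R) (r1 r2 : R) (x : R) : R :=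
  - (variational g w x / (2 * sqrt (radicand a b C1 g w))) * r1
  + variational h w x / (2 * sqrt (radicand a b C2 h w)) * r2
  + 1/4 * (w x - Derive_n w 2 x).

(* Classical solutions on 0 <= t <= T; [ut] is the time derivative of [u],
   left-sided at t = T. *)
Record is_solution (a b T C1 C2 : R) (u0 : R -> R) (u ut : R -> R -> R)
    (q1 q2 : R -> R) : Prop := {
  sol_reg0 : jointly_Cx 1 (fun t => 0 <= t <= T) u;
  sol_reg : jointly_Cx 3 (fun t => 0 < t <= T) u;
  sol_reg_t : jointly_Cx 2 (fun t => 0 < t <= T) ut;
  sol_q1_cont : continuous_on (fun t => 0 <= t <= T) q1;
  sol_q2_cont : continuous_on (fun t => 0 <= t <= T) q2;
  sol_ut : forall x t, 0 < t <= T ->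
    is_derive_within (fun s => 0 <= s <= T) (fun s => u x s) t (ut x t);
  sol_u : forall t, 0 < t <= T ->
    is_calD (b - a) (flux a b C1 C2 (fun x => u x t) (q1 t) (q2 t))
      (fun x => ut x t);
  sol_q1 : forall t, 0 < t <= T ->
    is_derive_within (fun s => 0 <= s <= T) q1 t
      (inner a b
        (fun x => 1 / (2 * sqrt (radicand a b C1 g (fun y => u y t)))
                  * variational g (fun y => u y t) x)
        (fun x => ut x t));
  sol_q2 : forall t, 0 < t <= T ->
    is_derive_within (fun s => 0 <= s <= T) q2 t
      (inner a b
        (fun x => 1 / (2 * sqrt (radicand a b C2 h (fun y => u y t)))
                  * variational h (fun y => u y t) x)
        (fun x => ut x t));
  sol_u_init : forall x, u x 0 = u0 x;
  sol_q1_init : q1 0 = sqrt (radicand a b C1 g u0);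
  sol_q2_init : q2 0 = sqrt (radicand a b C2 h u0);
  sol_periodic : forall t, 0 <= t <= T -> periodic (b - a) (fun x => u x t)
}.

Definition energy (a b C1 C2 : R) (w : R -> R) (r1 r2 : R) : R :=
  1/8 * RInt (fun x => (w x)^2 + (Derive w x)^2) a b
  - 1/2 * r1^2 + 1/2 * r2^2 + 1/2 * C1 - 1/2 * C2.

(* Main.v *)
(** Put [m = u - u_xx]. Pairing the equation [u_t = D F] with its own flux [F]
    gives [(F, D F) = 0], and by the equations for [q1] and [q2] this reads
    [1/4 (m, u_t) - q1 q1' + q2 q2' = 0].  It remains to see that
    [d/dt (u^2 + u_x^2, 1) = 2 (m, u_t)]. No time derivative of [u_x] is
    available, so the difference of the two energies is first rewritten by
    periodic integration by parts as
    [(m(s) + m(t), u(s) - u(t))]; the mean value theorem in time and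
    uniform continuity on the compact period then give the limit. *)

Require Import Defs.
From Stdlib Require Import Reals Lra Lia IndefiniteDescription.
From Coquelicot Require Import Coquelicot.
Open Scope R_scope.

(** * One-sided derivatives and the mean value theorem in time *)

(** [filterdiff] demands its estimate at every limit point of the filter. As [t] lies in [I], the
    filter meets every neighbourhood of [t] and [t] is its only limit point, so what remains is a
    plain epsilon-delta estimate at [t]. *)
Lemma is_derive_within_iff (I : R -> Prop) (f : R -> R) (t l : R) :
  I t ->
  is_derive_within I f t l <->
  forall eps : posreal, exists d : posreal, forall s, I s -> Rabs (s - t) < d ->
    Rabs (f s - f t - (s - t) * l) <= eps * Rabs (s - t).
Proof.
intros It. split.
- intros [_ H] eps.
  destruct (H t) with (eps := eps) as [d Hd].
  { intros P [d Hd]. exists d. intros y Hy _. now apply Hd. }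
  exists d. intros s Is Hs. exact (Hd s Hs Is).
- intros H. split; [exact (is_linear_scal_l (K := R_AbsRing) (V := R_NormedModule) l)|].
  intros x Hx.
  assert (E : x = t).
  { apply eq_close. intros eps.
    destruct (Hx (ball x eps)) as [d Hd]; [now exists eps|].
    apply Hd; [apply ball_center | exact It]. }
  subst x. intros eps. destruct (H eps) as [d Hd].
  exists d. intros s Hs Is. exact (Hd s Is Hs).
Qed.

Lemma is_derive_within_sqr (I : R -> Prop) (f : R -> R) (t l : R) :
  I t -> is_derive_within I f t l ->
  is_derive_within I (fun s => (f s)^2) t (2 * f t * l).
Proof.
intros It. rewrite !is_derive_within_iff by exact It. intros H eps.
assert (He := cond_pos eps).
assert (HF := Rabs_pos (f t)). assert (Hl := Rabs_pos l).
(* Once the remainder [r] is at most [Rabs (s - t)], the increment of [f] is at most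
   [(1 + Rabs l) * Rabs (s - t)], so [K] controls its square. *)
set (K := (1 + Rabs l)^2).
assert (HK : 0 < K) by (unfold K; nra).
assert (P1 : 0 < Rmin 1 (eps / (2 * (2 * Rabs (f t) + 1)))).
{ apply Rmin_pos; [lra|]. apply Rdiv_lt_0_compat; lra. }
destruct (H (mkposreal _ P1)) as [d Hd]. simpl in Hd.
assert (P2 : 0 < Rmin d (eps / (2 * K))).
{ apply Rmin_pos; [apply cond_pos|]. apply Rdiv_lt_0_compat; lra. }
exists (mkposreal _ P2). intros s Is Hs. simpl in Hs.
assert (Hs1 := Rlt_le_trans _ _ _ Hs (Rmin_l _ _)).
assert (Hs2 := Rlt_le_trans _ _ _ Hs (Rmin_r _ _)).
specialize (Hd s Is Hs1).
assert (Hh := Rabs_pos (s - t)).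
set (r := f s - f t - (s - t) * l) in *.
replace ((f s)^2 - (f t)^2 - (s - t) * (2 * f t * l))
  with (2 * f t * r + (r + (s - t) * l)^2) by (unfold r; ring).
assert (Q1 : Rabs r <= Rabs (s - t)).
{ eapply Rle_trans; [exact Hd|]. rewrite <- (Rmult_1_l (Rabs (s - t))) at 2.
  apply Rmult_le_compat_r; [exact Hh | apply Rmin_l]. }
assert (Q2 : Rabs (2 * f t * r) <= eps / 2 * Rabs (s - t)).
{ rewrite !Rabs_mult, (Rabs_pos_eq 2) by lra.
  assert (Q : Rabs r <= eps / (2 * (2 * Rabs (f t) + 1)) * Rabs (s - t)).
  { eapply Rle_trans; [exact Hd|].
    apply Rmult_le_compat_r; [exact Hh | apply Rmin_r]. }
  replace (eps / 2 * Rabs (s - t)) with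
    ((2 * Rabs (f t) + 1) * (eps / (2 * (2 * Rabs (f t) + 1)) * Rabs (s - t)))
    by (field; lra).
  apply Rmult_le_compat; [lra | apply Rabs_pos | lra | exact Q]. }
assert (Q3 : Rabs ((r + (s - t) * l)^2) <= eps / 2 * Rabs (s - t)).
{ rewrite <- RPow_abs.
  assert (Q : Rabs (r + (s - t) * l) <= Rabs (s - t) * (1 + Rabs l)).
  { eapply Rle_trans; [apply Rabs_triang|]. rewrite Rabs_mult. lra. }
  apply Rle_trans with ((Rabs (s - t) * (1 + Rabs l))^2).
  { apply pow_incr. split; [apply Rabs_pos | exact Q]. }
  replace ((Rabs (s - t) * (1 + Rabs l))^2) with (K * Rabs (s - t) * Rabs (s - t))
    by (unfold K; ring).
  apply Rmult_le_compat_r; [exact Hh|].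
  replace (eps / 2) with (K * (eps / (2 * K))) by (field; apply Rgt_not_eq; exact HK).
  apply Rmult_le_compat_l; lra. }
eapply Rle_trans; [apply Rabs_triang|]. lra.
Qed.

(** Makes the mean value theorem available up to the final time [T], where only a left derivative
    exists. It is used on [u x] for each fixed [x]. *)
Lemma MVT_within (T : R) (f df : R -> R) (t s : R) :
  (forall r, 0 < r <= T -> is_derive_within (fun r => 0 <= r <= T) f r (df r)) ->
  0 < t <= T -> 0 < s <= T ->
  exists c, Rmin t s <= c <= Rmax t s /\ f s - f t = df c * (s - t).
Proof.
intros H Ht Hs.
assert (B : forall x, Rmin t s <= x <= Rmax t s -> 0 < x <= T).
{ intros x. unfold Rmin, Rmax. destruct (Rle_dec t s); lra. }
assert (B' : forall x, Rmin t s < x < Rmax t s -> 0 < x < T).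
{ intros x. unfold Rmin, Rmax. destruct (Rle_dec t s); lra. }
(* Clamping at [T] turns the one-sided continuity there into a two-sided one. *)
destruct (MVT_gen (fun r => f (Rmin r T)) t s df) as [c [Hc E]].
- intros x Hx. apply B' in Hx.
  assert (Hx0 : 0 < x <= T) by lra. assert (Hx1 : 0 <= x <= T) by lra.
  generalize (H x Hx0). rewrite (is_derive_within_iff _ _ _ _ Hx1). intros D.
  apply is_derive_Reals. intros eps He.
  assert (He2 : 0 < eps / 2) by lra.
  destruct (D (mkposreal _ He2)) as [d Hd]. simpl in Hd.
  (* This radius keeps [x + k] between [0] and [T], where the clamp is the identity. *)
  assert (P : 0 < Rmin d (Rmin x (T - x))).
  { apply Rmin_pos; [apply cond_pos | apply Rmin_pos; lra]. }
  exists (mkposreal _ P). simpl. intros k Hk0 Hk.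
  assert (K1 := Rlt_le_trans _ _ _ Hk (Rmin_l _ _)).
  assert (K2 := Rlt_le_trans _ _ _ Hk (Rmin_r _ _)).
  assert (K3 := Rlt_le_trans _ _ _ K2 (Rmin_l _ _)).
  assert (K4 := Rlt_le_trans _ _ _ K2 (Rmin_r _ _)).
  apply Rabs_def2 in K3. apply Rabs_def2 in K4.
  rewrite !Rmin_left by lra.
  specialize (Hd (x + k) ltac:(lra)).
  replace (x + k - x) with k in Hd by ring. specialize (Hd K1).
  replace ((f (x + k) - f x) / k - df x) with ((f (x + k) - f x - k * df x) / k)
    by (field; lra).
  assert (Hkp := Rabs_pos_lt _ Hk0).
  unfold Rdiv. rewrite Rabs_mult, Rabs_inv.
  apply Rle_lt_trans with (eps / 2 * Rabs k * / Rabs k).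
  + apply Rmult_le_compat_r; [left; now apply Rinv_0_lt_compat | exact Hd].
  + rewrite Rmult_assoc, Rinv_r; lra.
- intros x Hx. apply B in Hx.
  assert (Hx1 : 0 <= x <= T) by lra.
  generalize (H x Hx). rewrite (is_derive_within_iff _ _ _ _ Hx1). intros D.
  (* Tolerance [1] in the derivative estimate already gives a Lipschitz bound at [x], hence
     continuity there. *)
  destruct (D (mkposreal 1 Rlt_0_1)) as [d Hd]. simpl in Hd.
  apply continuity_pt_locally. intros eps.
  assert (Hl := Rabs_pos (df x)). assert (He := cond_pos eps).
  assert (P : 0 < Rmin (Rmin d x) (eps / (2 + Rabs (df x)))).
  { apply Rmin_pos; [apply Rmin_pos; [apply cond_pos | lra]|].
    apply Rdiv_lt_0_compat; lra. }
  exists (mkposreal _ P). simpl. intros y Hy.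
  change (Rabs (y - x) < Rmin (Rmin d x) (eps / (2 + Rabs (df x)))) in Hy.
  rewrite (Rmin_left x T) by lra.
  (* Since [x <= T], clamping [y] does not move it away from [x]. *)
  assert (Z : Rabs (Rmin y T - x) <= Rabs (y - x)).
  { unfold Rmin. destruct (Rle_dec y T); [lra|].
    rewrite !Rabs_pos_eq by lra. lra. }
  assert (K1 := Rlt_le_trans _ _ _ Hy (Rmin_l _ _)).
  assert (K2 := Rlt_le_trans _ _ _ Hy (Rmin_r _ _)).
  assert (K3 := Rlt_le_trans _ _ _ K1 (Rmin_l _ _)).
  assert (K4 := Rlt_le_trans _ _ _ K1 (Rmin_r _ _)).
  apply Rabs_def2 in K4.
  assert (Iy : 0 <= Rmin y T <= T).
  { split; [apply Rmin_glb; lra | apply Rmin_r]. }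
  specialize (Hd (Rmin y T) Iy (Rle_lt_trans _ _ _ Z K3)).
  set (k := Rmin y T - x) in *.
  replace (f (Rmin y T) - f x) with ((f (Rmin y T) - f x - k * df x) + k * df x)
    by ring.
  eapply Rle_lt_trans; [apply Rabs_triang|]. rewrite Rabs_mult.
  assert (Hkp := Rabs_pos k).
  apply Rle_lt_trans with ((2 + Rabs (df x)) * Rabs (y - x)).
  + apply Rle_trans with ((2 + Rabs (df x)) * Rabs k); [nra|].
    apply Rmult_le_compat_l; lra.
  + apply Rlt_le_trans with ((2 + Rabs (df x)) * (eps / (2 + Rabs (df x)))).
    * apply Rmult_lt_compat_l; lra.
    * right. field. lra.
- exists c. split; [exact Hc|]. rewrite !Rmin_left in E by lra. exact E.
Qed.

(** * Joint continuity over a compact space interval *)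

(** A tube argument: each point [(x, t)] has its own radius, and compactness of [[a, b]] yields a
    radius that serves all [x] at once. *)
Lemma continuous_on_uniform_time (I : R -> Prop) (f : R * R -> R) (a b t : R) :
  I t -> continuous_on (fun z : R * R => I (snd z)) f ->
  forall eps : posreal, exists d : posreal, forall x s,
    a <= x <= b -> I s -> Rabs (s - t) < d -> Rabs (f (x, s) - f (x, t)) < eps.
Proof.
intros It Hf eps.
assert (He2 : 0 < eps / 2) by (generalize (cond_pos eps); lra).
assert (L : forall x, exists d : posreal, forall y s,
  Rabs (y - x) < d -> Rabs (s - t) < d -> I s ->
  Rabs (f (y, s) - f (x, t)) < eps / 2).
{ intros x.
  destruct (Hf (x, t) It (ball (f (x, t)) (mkposreal _ He2))) as [d Hd].
  { now exists (mkposreal _ He2). }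
  exists d. intros y s Hy Hs Is. apply (Hd (y, s)); [split; assumption | exact Is]. }
(* The compactness theorem takes a gauge function, so the local radii are gathered by choice. *)
set (delta := fun x => proj1_sig (constructive_indefinite_description _ (L x))).
assert (Hdelta := fun x =>
  proj2_sig (constructive_indefinite_description _ (L x))).
fold delta in Hdelta.
destruct (compactness_value_1d a b delta) as [d Hd].
exists d. intros x s Hx Is Hs.
(* Compactness provides the covering point [y] only under a double negation, hence the proof by
   contradiction. Both values [f (x, s)] and [f (x, t)] are then within [eps / 2] of [f (y, t)]. *)
apply Rnot_le_lt. intros N. apply (Hd x Hx). intros [y [_ [Hy Hdy]]].
assert (A1 := Hdelta y x s Hy (Rlt_le_trans _ _ _ Hs Hdy) Is).
assert (A2 := Hdelta y x t Hy).
rewrite Rminus_diag, Rabs_R0 in A2.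
specialize (A2 (cond_pos _) It).
apply Rle_not_lt in N. apply N.
replace (f (x, s) - f (x, t)) with ((f (x, s) - f (y, t)) - (f (x, t) - f (y, t)))
  by ring.
eapply Rle_lt_trans; [apply Rabs_triang|]. rewrite Rabs_Ropp. lra.
Qed.

Lemma continuous_on_slice (I : R -> Prop) (f : R * R -> R) (t x : R) :
  I t -> continuous_on (fun z : R * R => I (snd z)) f ->
  continuous (fun y => f (y, t)) x.
Proof.
intros It Hf P HP. destruct (Hf (x, t) It P HP) as [d Hd].
exists d. intros y Hy. apply (Hd (y, t)); [|exact It].
split; [exact Hy | apply ball_center].
Qed.

(** * Periodicity and continuity of the variational derivatives *)

Definition C2_function (w : R -> R) : Prop :=
  (forall x, is_derive w x (Derive w x)) /\
  (forall x, is_derive (Derive w) x (Derive_n w 2 x)) /\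
  (forall x, continuous (Derive_n w 2) x).

Lemma jointly_Cx_C2_function (n : nat) (I : R -> Prop) (v : R -> R -> R) (t : R) :
  (2 <= n)%nat -> jointly_Cx n I v -> I t -> C2_function (fun x => v x t).
Proof.
intros Hn Hv It. split; [|split]; intros x.
- apply Derive_correct. apply (proj1 (Hv 1%nat ltac:(lia)) x t It).
- apply Derive_correct. apply (proj1 (Hv 2%nat ltac:(lia)) x t It).
- exact (continuous_on_slice I _ t x It (proj2 (Hv 2%nat ltac:(lia)))).
Qed.

Lemma is_derive_continuous (f : R -> R) (x l : R) :
  is_derive f x l -> continuous f x.
Proof. intros H. apply (ex_derive_continuous f). now exists l. Qed.

Lemma continuous_Rmult (f1 f2 : R -> R) (x : R) :
  continuous f1 x -> continuous f2 x -> continuous (fun y => f1 y * f2 y) x.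
Proof. exact (continuous_mult f1 f2 x). Qed.

Lemma continuous_pow (f : R -> R) (n : nat) (x : R) :
  continuous f x -> continuous (fun y => (f y)^n) x.
Proof.
intros H. induction n as [|n IH]; [apply continuous_const|].
exact (continuous_Rmult f (fun y => (f y)^n) x H IH).
Qed.

Lemma ex_RInt_cont (f : R -> R) (a b : R) :
  (forall x, continuous f x) -> ex_RInt f a b.
Proof. intros H. apply (ex_RInt_continuous f). intros x _. apply H. Qed.

(** [Derive] is a total function, the limit of difference quotients, and the quotients at [x + L]
    and at [x] coincide. *)
Lemma periodic_Derive (L : R) (v : R -> R) :
  periodic L v -> periodic L (Derive v).
Proof.
intros H x. unfold Derive. f_equal. apply Lim_ext. intros k.
replace (x + L + k) with (x + k + L) by ring. now rewrite !H.
Qed.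

Lemma periodic_variational (L : R) (phi : R -> R -> R) (w : R -> R) :
  periodic L w -> periodic L (variational phi w).
Proof.
intros H x. assert (H1 := periodic_Derive L w H).
unfold variational. rewrite (H x), (H1 x). f_equal.
apply (periodic_Derive L (fun y => Derive (fun p => phi (w y) p) (Derive w y))).
intros y. now rewrite (H y), (H1 y).
Qed.

(* Syntactic matching keeps [apply] from unfolding [Rminus] or [pow] endlessly. *)
Ltac continuous_tac :=
  repeat match goal with
  | |- continuous (fun _ => ?c) _ => apply continuous_const
  | |- continuous (fun x => @?f x - @?g x) _ =>
      apply (continuous_minus (V := R_NormedModule) f g)
  | |- continuous (fun x => @?f x + @?g x) _ =>
      apply (continuous_plus (V := R_NormedModule) f g)
  | |- continuous (fun x => @?f x * @?g x) _ => apply (continuous_Rmult f g)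
  | |- continuous (fun x => (@?f x)^_) _ => apply (continuous_pow f)
  | |- _ => assumption
  end.

(** Expanding the total [x]-derivative gives the closed form [E], a polynomial in [w] and its first
    two derivatives, which are all continuous. *)
Lemma continuous_variational_g (w : R -> R) (x : R) :
  C2_function w -> continuous (variational g w) x.
Proof.
intros (H1 & H2 & H3).
assert (E : forall y, 2 * (w y + 1/2) * (2 * (w y)^2 + (Derive w y)^2 + 1/2 * w y)
  - (2 * Derive_n w 2 y * (w y + 1/2)^2 + 4 * (Derive w y)^2 * (w y + 1/2))
  = variational g w y).
{ intros y. unfold variational, g. f_equal.
  - symmetry. apply is_derive_unique. auto_derive; [exact I | field].
  - symmetry.
    (* The inner partial derivative is evaluated at every point first, since the outer one
       differentiates it as a function of [x]. *)
    rewrite (Derive_ext _ (fun z => 2 * Derive w z * (w z + 1/2)^2)).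
    + apply is_derive_unique.
      assert (D1 := H1 y). assert (D2 := H2 y).
      evar_last.
      { apply (is_derive_mult (fun z => 2 * Derive w z) (fun z => (w z + 1/2)^2)).
        - apply (is_derive_scal (Derive w)). exact D2.
        - apply (is_derive_pow (fun z => w z + 1/2)).
          apply (is_derive_plus w (fun _ => 1/2)); [exact D1 | apply @is_derive_const].
        - exact Rmult_comm. }
      unfold plus, mult, zero. simpl. field.
    + intros z. apply is_derive_unique. auto_derive; [exact I | field]. }
apply (continuous_ext _ _ x E).
assert (K1 := is_derive_continuous _ _ _ (H1 x)).
assert (K2 := is_derive_continuous _ _ _ (H2 x)).
assert (K3 := H3 x).
continuous_tac.
Qed.

Lemma continuous_variational_h (w : R -> R) (x : R) :
  C2_function w -> continuous (variational h w) x.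
Proof.
intros (H1 & H2 & H3).
assert (E : forall y, 4 * (w y)^3 + 2 * w y * (Derive w y)^2
  - (2 * Derive_n w 2 y * (w y)^2 + 4 * (Derive w y)^2 * w y)
  = variational h w y).
{ intros y. unfold variational, h. f_equal.
  - symmetry. apply is_derive_unique. auto_derive; [exact I | ring].
  - symmetry.
    rewrite (Derive_ext _ (fun z => 2 * Derive w z * (w z)^2)).
    + apply is_derive_unique.
      evar_last.
      { apply (is_derive_mult (fun z => 2 * Derive w z) (fun z => (w z)^2)).
        - apply (is_derive_scal (Derive w)). exact (H2 y).
        - apply (is_derive_pow w). exact (H1 y).
        - exact Rmult_comm. }
      unfold plus, mult. simpl. ring.
    + intros z. apply is_derive_unique. auto_derive; [exact I | ring]. }
apply (continuous_ext _ _ x E).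
assert (K1 := is_derive_continuous _ _ _ (H1 x)).
assert (K2 := is_derive_continuous _ _ _ (H2 x)).
assert (K3 := H3 x).
continuous_tac.
Qed.

(** * Skew-adjointness of the operator *)

(** From [F' = v - v''], the product [F v] is the derivative of a periodic function built from [F],
    [v] and [v'], so its integral over one period vanishes. This is skew-adjointness on the
    diagonal. *)
Lemma calD_skew (a b : R) (F v : R -> R) :
  periodic (b - a) F -> is_calD (b - a) F v -> RInt (fun x => F x * v x) a b = 0.
Proof.
intros PF [DF [Pv [Dv E]]].
assert (D0 : forall x, is_derive F x (v x - Derive_n v 2 x)).
{ intros x. rewrite E. apply Derive_correct, DF. }
assert (D1 : forall x, is_derive v x (Derive v x)).
{ intros x. apply Derive_correct, (Dv 1%nat x). lia. }
assert (D2 : forall x, is_derive (Derive v) x (Derive_n v 2 x)).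
{ intros x. apply Derive_correct, (Dv 2%nat x). lia. }
set (P := fun x => 1/2 * (F x + Derive v x)^2 - 1/2 * (v x)^2).
(* [F v = P'] because [F + v_x] is a primitive of [v]. *)
assert (DP : forall x, is_derive P x (F x * v x)).
{ intros x. unfold P. evar_last.
  { apply (is_derive_minus (fun x => 1/2 * (F x + Derive v x)^2)
             (fun x => 1/2 * (v x)^2)).
    - apply (is_derive_scal (fun x => (F x + Derive v x)^2)).
      apply (is_derive_pow (fun x => F x + Derive v x)).
      apply (is_derive_plus F (Derive v)); [apply D0 | apply D2].
    - apply (is_derive_scal (fun x => (v x)^2)), (is_derive_pow v), D1. }
  unfold minus, plus, opp. simpl. field. }
apply is_RInt_unique.
replace 0 with (minus (P b) (P a)).
- apply (is_RInt_derive P).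
  + intros x _. apply DP.
  + intros x _. apply continuous_Rmult;
      eapply is_derive_continuous; [apply D0 | apply D1].
- assert (Pd := periodic_Derive _ _ Pv).
  replace b with (a + (b - a)) by ring.
  unfold P. rewrite (PF a), (Pv a), (Pd a). unfold minus, plus, opp. simpl. ring.
Qed.

(** * Time derivative of the squared Sobolev norm *)

(* Integration by parts moves the [x]-derivative of [w2 - w1] onto [w1 + w2],
   so that only [w2 - w1] itself has to be differentiated in time. *)
Lemma H1_energy_diff (a b : R) (w1 w2 : R -> R) :
  C2_function w1 -> C2_function w2 -> periodic (b - a) w1 -> periodic (b - a) w2 ->
  RInt (fun x => (w2 x)^2 + (Derive w2 x)^2) a b
  - RInt (fun x => (w1 x)^2 + (Derive w1 x)^2) a b
  = RInt (fun x => ((w1 x - Derive_n w1 2 x) + (w2 x - Derive_n w2 2 x))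
                   * (w2 x - w1 x)) a b.
Proof.
intros (A1 & A2 & A3) (B1 & B2 & B3) P1 P2.
assert (KA1 := fun x => is_derive_continuous _ _ _ (A1 x)).
assert (KA2 := fun x => is_derive_continuous _ _ _ (A2 x)).
assert (KB1 := fun x => is_derive_continuous _ _ _ (B1 x)).
assert (KB2 := fun x => is_derive_continuous _ _ _ (B2 x)).
(* Subtracting [P'] from the difference of the two energy densities cancels the product of first
   derivatives and leaves exactly the integrand on the right. [P] takes equal values at [a] and [b]
   by periodicity. *)
set (P := fun x => (Derive w1 x + Derive w2 x) * (w2 x - w1 x)).
set (dP := fun x => (Derive_n w1 2 x + Derive_n w2 2 x) * (w2 x - w1 x)
                    + (Derive w1 x + Derive w2 x) * (Derive w2 x - Derive w1 x)).
assert (DP : forall x, is_derive P x (dP x)).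
{ intros x. apply (is_derive_mult (fun x => Derive w1 x + Derive w2 x)
                     (fun x => w2 x - w1 x)).
  - apply (is_derive_plus (Derive w1) (Derive w2)); auto.
  - apply (is_derive_minus w2 w1); auto.
  - exact Rmult_comm. }
assert (CP : forall x, continuous dP x).
{ intros x. unfold dP.
  specialize (KA1 x); specialize (KA2 x); specialize (KB1 x);
  specialize (KB2 x); specialize (A3 x); specialize (B3 x). continuous_tac. }
assert (IP : is_RInt dP a b 0).
{ replace 0 with (minus (P b) (P a)).
  - apply (is_RInt_derive P); intros x _; [apply DP | apply CP].
  - assert (Q1 := periodic_Derive _ _ P1). assert (Q2 := periodic_Derive _ _ P2).
    replace b with (a + (b - a)) by ring.
    unfold P. rewrite (P1 a), (P2 a), (Q1 a), (Q2 a).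
    unfold minus, plus, opp. simpl. ring. }
symmetry. apply is_RInt_unique.
assert (I2 : is_RInt (fun x => (w2 x)^2 + (Derive w2 x)^2) a b
  (RInt (fun x => (w2 x)^2 + (Derive w2 x)^2) a b)).
{ apply (RInt_correct (V := R_CompleteNormedModule)). apply ex_RInt_cont. intros x.
  specialize (KB1 x); specialize (KB2 x). continuous_tac. }
assert (I1 : is_RInt (fun x => (w1 x)^2 + (Derive w1 x)^2) a b
  (RInt (fun x => (w1 x)^2 + (Derive w1 x)^2) a b)).
{ apply (RInt_correct (V := R_CompleteNormedModule)). apply ex_RInt_cont. intros x.
  specialize (KA1 x); specialize (KA2 x). continuous_tac. }
assert (J := is_RInt_minus _ _ _ _ _ _ (is_RInt_minus _ _ _ _ _ _ I2 I1) IP).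
match type of J with is_RInt _ _ _ ?v => match goal with |- is_RInt _ _ _ ?w =>
  replace w with v by (unfold minus, plus, opp; simpl; ring) end end.
revert J. apply is_RInt_ext. intros x _. unfold dP, minus, plus, opp. simpl. ring.
Qed.

Lemma jointly_Cx_helmholtz_continuous (n : nat) (I : R -> Prop) (v : R -> R -> R) :
  (2 <= n)%nat -> jointly_Cx n I v ->
  continuous_on (fun z : R * R => I (snd z))
    (fun z : R * R => v (fst z) (snd z) - Derive_n (fun y => v y (snd z)) 2 (fst z)).
Proof.
intros Hn Hv z Hz.
eapply (filterlim_comp_2 (F := within (fun z : R * R => I (snd z)) (locally z))
  _ (fun z : R * R => - Derive_n (fun y => v y (snd z)) 2 (fst z))
  Rplus).
1: exact (proj2 (Hv 0%nat ltac:(lia)) z Hz).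
2: exact (filterlim_plus (V := R_NormedModule) _ _).
eapply filterlim_comp; [exact (proj2 (Hv 2%nat Hn) z Hz)|].
exact (filterlim_opp (V := R_NormedModule) _).
Qed.

Lemma bounded_on_segment (f : R -> R) (a b : R) :
  (forall x, continuous f x) ->
  exists M, 0 < M /\ forall x, a <= x <= b -> Rabs (f x) <= M.
Proof.
intros H.
destruct (bounded_continuity (V := R_NormedModule) f a b) as [M HM].
{ intros x _. apply H. }
exists (Rmax 1 M). split; [apply Rlt_le_trans with 1; [lra | apply Rmax_l]|].
intros x Hx. apply Rle_trans with M; [left; exact (HM x Hx) | apply Rmax_r].
Qed.

(** With [u x s - u x t = ut x c * (s - t)], the remainder has integrand [((m x s - m x t) * ut x c
    + 2 * m x t * (ut x c - ut x t)) * (s - t)]. The time [c] depends on [x], so both differences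
    must be small uniformly in [x]. *)
Lemma H1_energy_derive (a b T : R) (u ut : R -> R -> R) (t : R) :
  a < b ->
  jointly_Cx 2 (fun t => 0 < t <= T) u ->
  jointly_Cx 2 (fun t => 0 < t <= T) ut ->
  (forall x t, 0 < t <= T ->
    is_derive_within (fun s => 0 <= s <= T) (fun s => u x s) t (ut x t)) ->
  (forall t, 0 < t <= T -> periodic (b - a) (fun x => u x t)) ->
  0 < t <= T ->
  is_derive_within (fun s => 0 <= s <= T)
    (fun s => RInt (fun x => (u x s)^2 + (Derive (fun y => u y s) x)^2) a b) t
    (2 * RInt (fun x => (u x t - Derive_n (fun y => u y t) 2 x) * ut x t) a b).
Proof.
intros Hab Ru Rut Hut Pu Ht.
set (J := fun t => 0 < t <= T).
set (m := fun x s => u x s - Derive_n (fun y => u y s) 2 x).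
assert (Cm : forall s x, J s -> continuous (fun y => m y s) x).
{ intros s x Js.
  exact (continuous_on_slice J _ s x Js (jointly_Cx_helmholtz_continuous 2 J u (le_n _) Ru)). }
assert (Cu : forall s x, J s -> continuous (fun y => u y s) x).
{ intros s x Js. exact (continuous_on_slice J _ s x Js (proj2 (Ru 0%nat ltac:(lia)))). }
assert (Cut : forall s x, J s -> continuous (fun y => ut y s) x).
{ intros s x Js. exact (continuous_on_slice J _ s x Js (proj2 (Rut 0%nat ltac:(lia)))). }
destruct (bounded_on_segment (fun x => m x t) a b) as [M [HM Mm]].
{ intros x. now apply Cm. }
destruct (bounded_on_segment (fun x => ut x t) a b) as [N [HN Nut]].
{ intros x. now apply Cut. }
apply is_derive_within_iff; [lra|]. intros eps.
assert (He := cond_pos eps).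
(* With [eta <= 1], [N + 1] bounds [ut x c] in absolute value, so [K * eta] bounds the integral of
   the remainder per unit of [Rabs (s - t)]. *)
set (K := (b - a) * (N + 1 + 2 * M)).
assert (HK : 0 < K) by (unfold K; nra).
assert (P1 : 0 < Rmin 1 (eps / K)).
{ apply Rmin_pos; [lra | now apply Rdiv_lt_0_compat]. }
set (eta := mkposreal _ P1).
destruct (continuous_on_uniform_time J _ a b t Ht
  (jointly_Cx_helmholtz_continuous 2 J u (le_n _) Ru) eta) as [d1 Hd1].
destruct (continuous_on_uniform_time J _ a b t Ht
  (proj2 (Rut 0%nat ltac:(lia))) eta) as [d2 Hd2].
(* The bound by [t] keeps [s] positive: the second [x]-derivatives are controlled only at positive
   times. *)
assert (P2 : 0 < Rmin t (Rmin d1 d2)).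
{ apply Rmin_pos; [lra | apply Rmin_pos; apply cond_pos]. }
exists (mkposreal _ P2). intros s Is Hs. simpl in Hs.
assert (S1 := Rlt_le_trans _ _ _ Hs (Rmin_l _ _)).
assert (S2 := Rlt_le_trans _ _ _ Hs (Rmin_r _ _)).
assert (S3 := Rlt_le_trans _ _ _ S2 (Rmin_l _ _)).
assert (S4 := Rlt_le_trans _ _ _ S2 (Rmin_r _ _)).
assert (Js : J s) by (apply Rabs_def2 in S1; unfold J; lra).
rewrite (H1_energy_diff a b (fun x => u x t) (fun x => u x s)
  (jointly_Cx_C2_function 2 J u t (le_n _) Ru Ht)
  (jointly_Cx_C2_function 2 J u s (le_n _) Ru Js)
  (Pu t Ht) (Pu s Js)).
set (A := fun x => (m x t + m x s) * (u x s - u x t)).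
set (B := fun x => m x t * ut x t).
assert (EA : ex_RInt A a b).
{ apply ex_RInt_cont. intros x. unfold A.
  assert (Q1 := Cm t x Ht). assert (Q2 := Cm s x Js).
  assert (Q3 := Cu t x Ht). assert (Q4 := Cu s x Js). continuous_tac. }
assert (EB : ex_RInt B a b).
{ apply ex_RInt_cont. intros x. unfold B.
  assert (Q1 := Cm t x Ht). assert (Q2 := Cut t x Ht). continuous_tac. }
assert (EB' := ex_RInt_scal _ _ _ (2 * (s - t)) EB).
assert (ED : RInt A a b - (s - t) * (2 * RInt B a b)
  = RInt (fun x => minus (A x) (scal (2 * (s - t)) (B x))) a b).
{ symmetry. apply is_RInt_unique.
  apply (RInt_correct (V := R_CompleteNormedModule)) in EA.
  apply (RInt_correct (V := R_CompleteNormedModule)) in EB.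
  apply (is_RInt_scal _ _ _ (2 * (s - t))) in EB.
  evar_last; [exact (is_RInt_minus _ _ _ _ _ _ EA EB)|].
  unfold minus, plus, opp, scal. simpl. unfold mult. simpl. ring. }
change (Rabs (RInt A a b - (s - t) * (2 * RInt B a b)) <= eps * Rabs (s - t)).
rewrite ED.
apply Rle_trans with ((b - a) * ((N + 1 + 2 * M) * eta * Rabs (s - t))).
2: { replace ((b - a) * ((N + 1 + 2 * M) * eta * Rabs (s - t)))
       with (K * eta * Rabs (s - t)) by (unfold K; ring).
     apply Rmult_le_compat_r; [apply Rabs_pos|].
     apply Rle_trans with (K * (eps / K)).
     - apply Rmult_le_compat_l; [lra | apply Rmin_r].
     - right. field. lra. }
apply (abs_RInt_le_const _ a b); [lra | now apply (ex_RInt_minus (V := R_NormedModule)) |].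
intros x Hx.
destruct (MVT_within T (fun r => u x r) (fun r => ut x r) t s (Hut x) Ht Js)
  as [c [Hc Ec]].
assert (Sc : Rabs (c - t) <= Rabs (s - t)).
{ revert Hc. unfold Rmin, Rmax, Rabs.
  destruct (Rle_dec t s); destruct (Rcase_abs (c - t)); destruct (Rcase_abs (s - t)); lra. }
assert (Jc : J c).
{ revert Hc. unfold J in *. unfold Rmin, Rmax. destruct (Rle_dec t s); lra. }
assert (U1 : Rabs (m x s - m x t) < eta) by exact (Hd1 x s Hx Js S3).
assert (U2 : Rabs (ut x c - ut x t) < eta).
{ exact (Hd2 x c Hx Jc (Rle_lt_trans _ _ _ Sc S4)). }
assert (E1 : eta <= 1) by apply Rmin_l.
assert (U3 : Rabs (ut x c) <= N + 1).
{ replace (ut x c) with (ut x t + (ut x c - ut x t)) by ring.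
  eapply Rle_trans; [apply Rabs_triang|]. specialize (Nut x Hx). lra. }
specialize (Mm x Hx).
replace (minus (A x) (scal (2 * (s - t)) (B x))) with
  (((m x s - m x t) * ut x c + 2 * m x t * (ut x c - ut x t)) * (s - t)).
2: { unfold A, B. rewrite Ec. unfold minus, plus, opp, scal. simpl. unfold mult. simpl. ring. }
rewrite Rabs_mult. apply Rmult_le_compat_r; [apply Rabs_pos|].
eapply Rle_trans; [apply Rabs_triang|]. rewrite !Rabs_mult, (Rabs_pos_eq 2) by lra.
assert (H1 := Rabs_pos (m x s - m x t)). assert (H2 := Rabs_pos (ut x c - ut x t)).
assert (H3 := Rabs_pos (m x t)). assert (H4 := Rabs_pos (ut x c)).
replace ((N + 1 + 2 * M) * eta) with (eta * (N + 1) + 2 * M * eta) by ring.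
apply Rplus_le_compat; apply Rmult_le_compat; lra.
Qed.

(** * Conservation of the modified energy *)

Theorem theorem2p1 :
  forall (a b T C1 C2 : R) (u0 : R -> R) (u ut : R -> R -> R) (q1 q2 : R -> R),
    a < b -> 0 < T ->
    (forall t, 0 <= t <= T -> 0 < radicand a b C1 g (fun x => u x t)) ->
    (forall t, 0 <= t <= T -> 0 < radicand a b C2 h (fun x => u x t)) ->
    is_solution a b T C1 C2 u0 u ut q1 q2 ->
    forall t, 0 < t <= T ->
      is_derive_within (fun s => 0 <= s <= T)
        (fun s => energy a b C1 C2 (fun x => u x s) (q1 s) (q2 s)) t 0.
Proof.
intros a b T C1 C2 u0 u ut q1 q2 Hab HT Hg Hh S t Ht.
assert (It : 0 <= t <= T) by lra.
destruct S as [_ Ru Rut _ _ Hut Hu Hq1 Hq2 _ _ _ Pu].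
specialize (Hu t Ht). specialize (Hq1 t Ht). specialize (Hq2 t Ht).
set (w := fun x => u x t) in *. set (v := fun x => ut x t) in *.
assert (Cw : C2_function w) by exact (jointly_Cx_C2_function 3 _ u t ltac:(lia) Ru Ht).
assert (Pw : periodic (b - a) w) by exact (Pu t It).
assert (Ru2 : jointly_Cx 2 (fun t => 0 < t <= T) u) by (intros k Hk; apply Ru; lia).
assert (DN := H1_energy_derive a b T u ut t Hab Ru2 Rut Hut
  (fun s Hs => Pu s (conj (Rlt_le _ _ (proj1 Hs)) (proj2 Hs))) Ht).
apply is_derive_within_sqr in Hq1; [|exact It].
apply is_derive_within_sqr in Hq2; [|exact It].
set (G := 1 / (2 * sqrt (radicand a b C1 g w))) in *.
set (H := 1 / (2 * sqrt (radicand a b C2 h w))) in *.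
set (IM := RInt (fun x => (u x t - Derive_n (fun y => u y t) 2 x) * ut x t) a b) in *.
set (IG := inner a b (fun x => G * variational g w x) v) in *.
set (IH := inner a b (fun x => H * variational h w x) v) in *.
assert (PF : periodic (b - a) (flux a b C1 C2 w (q1 t) (q2 t))).
{ intros x. unfold flux.
  assert (P1 := periodic_Derive _ _ (periodic_Derive _ _ Pw) x).
  change (Derive_n w 2 (x + (b - a)) = Derive_n w 2 x) in P1.
  now rewrite (periodic_variational _ g w Pw x), (periodic_variational _ h w Pw x),
    (Pw x), P1. }
(* The flux is paired with its own image, the time derivative of [u]. *)
assert (Z := calD_skew a b _ v PF Hu).
assert (Kv : forall x, continuous v x).
{ intros x. exact (continuous_on_slice _ _ t x Ht (proj2 (Rut 0%nat ltac:(lia)))). }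
assert (Kg := fun x => continuous_variational_g w x Cw).
assert (Kh := fun x => continuous_variational_h w x Cw).
(* Splitting the flux in [Z] into its three terms turns the pairing into this balance: [IG] and [IH]
   are the time derivatives of [q1] and [q2]. *)
assert (Bal : 1/4 * IM - q1 t * IG + q2 t * IH = 0).
{ rewrite <- Z. symmetry. apply is_RInt_unique.
  assert (XM : is_RInt (fun x => (w x - Derive_n w 2 x) * v x) a b IM).
  { apply (RInt_correct (V := R_CompleteNormedModule)), ex_RInt_cont. intros x.
    destruct Cw as (W1 & _ & W3).
    assert (Q1 := is_derive_continuous _ _ _ (W1 x)).
    specialize (W3 x). specialize (Kv x). continuous_tac. }
  assert (XG : is_RInt (fun x => G * variational g w x * v x) a b IG).
  { apply (RInt_correct (V := R_CompleteNormedModule)), ex_RInt_cont. intros x.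
    specialize (Kg x). specialize (Kv x). continuous_tac. }
  assert (XH : is_RInt (fun x => H * variational h w x * v x) a b IH).
  { apply (RInt_correct (V := R_CompleteNormedModule)), ex_RInt_cont. intros x.
    specialize (Kh x). specialize (Kv x). continuous_tac. }
  apply (is_RInt_scal _ _ _ (1/4)) in XM.
  apply (is_RInt_scal _ _ _ (q1 t)) in XG.
  apply (is_RInt_scal _ _ _ (q2 t)) in XH.
  assert (X := is_RInt_plus _ _ _ _ _ _ (is_RInt_minus _ _ _ _ _ _ XM XG) XH).
  revert X. apply is_RInt_ext. intros x _.
  unfold flux, G, H, minus, plus, opp, scal, Rdiv. simpl. unfold mult. simpl. ring. }
set (EN := fun s => RInt (fun x => (u x s)^2 + (Derive (fun y => u y s) x)^2) a b) in *.
assert (FF : Filter (within (fun s => 0 <= s <= T) (locally t))) by typeclasses eauto.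
assert (D1 := filterdiff_scal_r_fct (1/8) _ _ Rmult_comm DN).
assert (D2 := filterdiff_scal_r_fct (- (1/2)) _ _ Rmult_comm Hq1).
assert (D3 := filterdiff_scal_r_fct (1/2) _ _ Rmult_comm Hq2).
assert (D := filterdiff_plus_fct _ _ _ _ (filterdiff_plus_fct _ _ _ _
  (filterdiff_plus_fct _ _ _ _ D1 D2) D3)
  (filterdiff_const (F := within (fun s => 0 <= s <= T) (locally t))
     (1/2 * C1 - 1/2 * C2))).
eapply filterdiff_ext; [|eapply filterdiff_ext_lin; [exact D|]].
- intros s. unfold EN, energy, plus, scal. simpl. unfold mult. simpl. field.
- intros y. unfold plus, scal, zero. simpl. unfold mult. simpl.
  (* The factors [2] from the squares and from the Sobolev term turn the energy weights [1/8],
     [-1/2], [1/2] into the coefficients of [Bal]. *)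
  transitivity (y * (1/4 * IM - q1 t * IG + q2 t * IH)); [field|].
  now rewrite Bal.
Qed.
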